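(* Consider the single-firm stochastic inventory control problem described in the context, with horizon $T$, inventory bounds $x^L,x^U$, unit production cost $c>0$, shortage and holding prices $s,h>0$, penalty function $f$, and random demands $\omega^k$ with support bounded in $[d^k,D^k]$. For each stage $k=0,\dots,T-1$, there exists a threshold $M^k$, which is independent of the current inventory level $x^k$ and is a function of the parameters $c,s,h$, such that the optimal request policy has the form $$N^{k,\star}=\Big[(M^k-x^k)_+\Big]^{\overline N^k(x^k)}_{\underline N^k(x^k)},$$ where $\overline N^k(x^k)=x^U-x^k$ and $\underline N^k(x^k)=x^L+D^k-x^k$.
   Context: Notation: $(u)_+=\max(u,0)$; $[u]^{\alpha}_{\beta}=\min\{\alpha,\max\{u,\beta\}\}$; expectations are over the demand. Control problem: $x^k$ is the inventory level of a firm's output good at stage $k$, $N^k$ the amount requested, $y^k=x^k+N^k$ the on-hand stock, and $\omega^k$ the random demand, modelled by a probability mass function, with support bounded in $[d^k,D^k]$. The firm minimizes $$\mathbb E\Big\{\sum_{k=0}^{T-1}\big(c\,N^k+f(x^k+N^k-\omega^k)\big)\Big\}$$ subject to $x^{k+1}=x^k+N^k-\omega^k$, $x^L\le x^k\le x^U$, $x^L+D^k\le x^k+N^k\le x^U$, $N^k\ge 0$, over policies mapping the current inventory level $x^k$ to a request $N^k$. Here $f$ is a penalty function for unmet demand or for having too many output goods stored; a commonly used example is the shortage/holding penalty $f(u)=s\,(-u)_++h\,(u)_+$, with shortage price $s$ and holding price $h$. The problem is solved by the Bellman recursion $J^T\equiv 0$ and, for $k=0,\dots,T-1$, $$J^k(x^k)=\min\{Q^k(y):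 y\ge x^k,\ x^L+D^k\le y\le x^U\}-c\,x^k,\qquad Q^k(y)=c\,y+\mathbb E\big\{f(y-\omega^k)+J^{k+1}(y-\omega^k)\big\};$$ the optimal request is $N^{k,\star}=y^{k,\star}-x^k$ with $y^{k,\star}$ a minimizer.
   Formalization: The penalty f is assumed convex for all s,h>0 (true of the shortage/holding penalty; the claim fails for general f with several local minima); demands are taken independent and nonnegative (d^k ≥ 0), and x^L + D^k ≤ x^U so that requests exist. *)

(* Defs.v *)
From mathcomp Require Import all_boot all_order all_algebra.
From mathcomp Require Import all_classical all_reals all_analysis.
From mathcomp Require Import ring.

Set Implicit Arguments.
Unset Strict Implicit.
Unset Printing Implicit Defensive.

Import Order.TTheory GRing.Theory Num.Theory.

Local Open Scope classical_set_scope.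
Local Open Scope ring_scope.

Section Demand.
Context (R : realType) (disp : measure_display) (Omega : measurableType disp)
  (P : probability Omega R).

Definition support_in (X : {dRV P >-> R}) (a b : R) : Prop :=
  forall r : R, @pmf _ _ _ P X r != 0 -> a <= r <= b.

(* The product rule for proper subfamilies is the case where some of the
   [A k] are [setT]. *)
Definition mutually_independent (T : nat) (w : nat -> {dRV P >-> R}) : Prop :=
  forall A : nat -> set R, (forall k, measurable (A k)) ->
    P (\bigcap_(k in `I_T) (w k @^-1` A k)) =
    (\prod_(k < T) P (w k @^-1` A k))%E.

End Demand.
Arguments support_in {R disp Omega} P X a b.
Arguments mutually_independent {R disp Omega} P T w.

Section ControlProblem.
Context (R : realType) (disp : measure_display) (Omega : measurableType disp)
  (P : probability Omega R).
Variables (T : nat) (xL xU c : R) (f : R -> R) (D : nat -> R)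
  (w : nat -> {dRV P >-> R}).

Definition policy := nat -> R -> R.

Fixpoint level (N : policy) (x0 : R) (k : nat) (t : Omega) : R :=
  if k is j.+1 then
    level N x0 j t + N j (level N x0 j t) - w j t
  else x0.

Definition total_cost (N : policy) (x0 : R) (t : Omega) : R :=
  \sum_(k < T)
    (c * N k (level N x0 k t)
     + f (level N x0 k t + N k (level N x0 k t) - w k t)).

Definition feasible (N : policy) (x0 : R) : Prop :=
  {ae P, forall t : Omega,
    (forall k, (k <= T)%N -> xL <= level N x0 k t <= xU) /\
    (forall k, (k < T)%N ->
       xL + D k <= level N x0 k t + N k (level N x0 k t) <= xU /\
       0 <= N k (level N x0 k t))}.

Definition optimal_policy (N : policy) (x0 : R) : Prop :=
  feasible N x0 /\
  forall N' : policy, feasible N' x0 ->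
    ('E_P[total_cost N x0] <= 'E_P[total_cost N' x0])%E.

Definition order_up_to (k : nat) (x : R) : set R :=
  [set y | x <= y /\ xL + D k <= y <= xU].

(* [fine] is harmless for the relevant [y]: the demand is bounded almost surely,
   so the expectation is finite. *)
Definition Q_of (Jnext : R -> R) (k : nat) (y : R) : R :=
  c * y + fine 'E_P[fun t => f (y - w k t) + Jnext (y - w k t)].

(* Value function at stage [k] when [n] stages remain.  The minimum is written
   as an infimum: for convex [f] it is attained at every [x] in [xL, xU], and
   only such levels are reached from admissible requests. *)
Fixpoint cost_to_go (n k : nat) (x : R) : R :=
  if n is m.+1 then
    inf [set Q_of (cost_to_go m k.+1) k y | y in order_up_to k x] - c * x
  else 0.

Definition J (k : nat) : R -> R := cost_to_go (T - k) k.

Definition Q (k : nat) : R -> R := Q_of (J k.+1) k.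

Definition bellman_optimal (k : nat) (x N : R) : Prop :=
  order_up_to k x (x + N) /\
  forall y, order_up_to k x y -> Q k (x + N) <= Q k y.

End ControlProblem.
Arguments optimal_policy {R disp Omega} P T xL xU c f D w N x0.
Arguments bellman_optimal {R disp Omega} P T xL xU c f D w k x N.

Section ThresholdPolicy.
Context (R : realType).

Definition pos_part (u : R) : R := Num.max u 0.

Definition clamp (alpha beta u : R) : R := Num.min alpha (Num.max u beta).

Definition threshold_policy (xL xU : R) (D M : nat -> R) : policy R :=
  fun k x => clamp (xU - x) (xL + D k - x) (pos_part (M k - x)).

(* The standard instance of a convex family of penalties indexed by the
   prices. *)
Definition shortage_holding (s h u : R) : R :=
  s * pos_part (- u) + h * pos_part u.

Lemma shortage_holding_convex (s h : R) : 0 < s -> 0 < h ->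
  convex_function [set: R^o] (shortage_holding s h).
Proof.
have pos_part_conv (p q a b : R) : 0 <= p -> 0 <= q ->
    pos_part (p * a + q * b) <= p * pos_part a + q * pos_part b.
  move=> p0 q0; rewrite /pos_part ge_max; apply/andP; split.
    by apply: lerD; apply: ler_wpM2l => //; rewrite le_max lexx.
  by apply: addr_ge0; apply: mulr_ge0 => //; rewrite le_max lexx orbT.
move=> s0 h0.
have conv (p x y : R) : 0 <= p -> p <= 1 ->
    shortage_holding s h (p * x + (1 - p) * y) <=
    p * shortage_holding s h x + (1 - p) * shortage_holding s h y.
  move=> p0 p1; have q0 : 0 <= 1 - p by rewrite subr_ge0.
  have -> : p * shortage_holding s h x + (1 - p) * shortage_holding s h y =
      s * (p * pos_part (- x) + (1 - p) * pos_part (- y)) +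
      h * (p * pos_part x + (1 - p) * pos_part y).
    by rewrite /shortage_holding; ring.
  apply: lerD; (apply: ler_wpM2l; first exact: ltW); last exact: pos_part_conv.
  by rewrite opprD -!mulrN; exact: pos_part_conv.
by move=> t x y _ _; apply: conv.
Qed.

End ThresholdPolicy.

(* Main.v *)
(* The cost-to-go functions [J_k] are convex and Lipschitz on [xL, xU], by
   backward induction: if [J_{k+1}] is, then so is [Q_k] on [xL + D_k, xU], hence
   [Q_k] has a minimizer [M_k] there and [J_k x = Q_k (max x M_k) - c x], because
   [Q_k] is nondecreasing to the right of [M_k].  The threshold policy is exactly
   the policy that orders up to [max x M_k].

   Optimality over all policies: the total cost is [J_0 x0] plus the sum over
   the stages of [c N_k + f x_{k+1} + J_{k+1} x_{k+1} - J_k x_k].  Since the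
   demand at stage [k] is independent of the past, conditionally on the past
   demands each summand has expectation [Q_k (x_k + N_k) - c x_k - J_k x_k],
   which is nonnegative for a feasible policy and zero for the threshold policy.
   The demands take countably many values, so conditioning is a countable sum
   over atoms, and arbitrary functions of past demands are measurable. *)
Require Import Defs.
From mathcomp Require Import all_boot all_order all_algebra.
From mathcomp Require Import all_classical all_reals all_analysis.
From mathcomp Require Import measurable_realfun ring lra.

Set Implicit Arguments.
Unset Strict Implicit.
Unset Printing Implicit Defensive.

Import Order.TTheory GRing.Theory Num.Theory.
Import numFieldNormedType.Exports.

Local Open Scope classical_set_scope.
Local Open Scope ring_scope.

(** * Random variables with values in nat *)

Section NatValued.
Context (R : realType) (disp : measure_display) (Omega : measurableType disp)
  (P : probability Omega R).

Lemma ae_bounded_integrable (g : Omega -> R) (C : R) :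
  measurable_fun setT g -> {ae P, forall t, `|g t| <= C} ->
  P.-integrable setT (EFin \o g).
Proof.
move=> mg gC; apply/integrableP; split; first exact/measurable_EFinP.
have C0 : 0 <= Num.max C 0 by rewrite le_max lexx orbT.
apply: (@le_lt_trans _ _ (\int[P]_t (Num.max C 0)%:E)%E).
  apply: ae_ge0_le_integral => //.
  - by apply: measurableT_comp => //; exact/measurable_EFinP.
  - by apply: filterS gC => t gt _ /=; rewrite lee_fin le_max gt.
by rewrite integral_cst// -[X in (_ * X)%E]/(P setT)
  probability_setT mule1 ltry.
Qed.

Lemma ae_ge0_Rintegral (g : Omega -> R) :
  measurable_fun setT g -> {ae P, forall t, 0 <= g t} ->
  0 <= \int[P]_t g t.
Proof.
move=> mg g0.
have -> : \int[P]_t g t = \int[P]_t Num.max (g t) 0.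
  congr fine; apply: ae_eq_integral => //; first exact/measurable_EFinP.
    by apply/measurable_EFinP; apply: measurable_maxr => //.
  by apply: filterS g0 => t /= gt _; rewrite max_l.
by apply: Rintegral_ge0 => t _; rewrite le_max lexx orbT.
Qed.

Lemma ae_le_Rintegral (g h : Omega -> R) :
  P.-integrable setT (EFin \o g) -> P.-integrable setT (EFin \o h) ->
  {ae P, forall t, g t <= h t} ->
  \int[P]_t g t <= \int[P]_t h t.
Proof.
move=> ig ih gh; rewrite -subr_ge0 -RintegralB//.
apply: ae_ge0_Rintegral; last by apply: filterS gh => t; rewrite subr_ge0.
by apply: measurable_funB; apply/measurable_EFinP;
  [exact: measurable_int ih|exact: measurable_int ig].
Qed.

(** Otherwise [A] would lie inside a null set. This supplies a representative sample point for an
    event of positive probability. *)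
Lemma ae_exists_in (A : set Omega) (Phi : Omega -> Prop) :
  measurable A -> P A != 0%E -> {ae P, forall t, Phi t} ->
  exists2 t, A t & Phi t.
Proof.
move=> mA PA0 [N [mN PN NPhi]]; apply: contrapT => none.
move: PA0; apply/negP/negPn; rewrite -measure_le0 -PN.
apply: le_measure; rewrite ?inE// => t At; apply: NPhi => Pt.
by apply: none; exists t.
Qed.

Lemma measurable_fun_nat (phi : nat -> R) (z : Omega -> nat) :
  measurable_fun setT z -> measurable_fun setT (fun t => phi (z t)).
Proof. by move=> mz; apply: (@measurableT_comp _ _ _ _ _ _ phi). Qed.

Section Fibers.
Variable z : Omega -> nat.
Hypothesis mz : measurable_fun setT z.

Lemma measurable_fiber (n : nat) : measurable (z @^-1` [set n]).
Proof. by rewrite -[_ @^-1` _]setTI; exact: mz. Qed.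

Lemma bigcup_fiber (A : set Omega) : \bigcup_n (A `&` z @^-1` [set n]) = A.
Proof.
by apply/seteqP; split=> [t [n _ []]//|t At]; exists (z t).
Qed.

Lemma trivIset_fiber (A : set Omega) :
  trivIset setT (fun n => A `&` z @^-1` [set n]).
Proof. by move=> m n _ _ [t [[_ <-] [_ <-]]]. Qed.

Lemma ge0_integral_fiber (A : set Omega) (g : nat -> \bar R) :
  measurable A -> (forall n, 0 <= g n)%E ->
  (\int[P]_(t in A) g (z t) =
   \sum_(n <oo) g n * P (A `&` z @^-1` [set n]))%E.
Proof.
move=> mA g0; have mAz n : measurable (A `&` z @^-1` [set n]).
  by apply: measurableI => //; exact: measurable_fiber.
rewrite -{1}(bigcup_fiber A) ge0_integral_bigcup//; last 2 first.
- rewrite bigcup_fiber; apply: measurable_funTS.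
  exact: (@measurableT_comp _ _ _ _ _ _ g).
- exact: trivIset_fiber.
apply: eq_eseriesr => n _; rewrite -integral_cst//.
by apply: eq_integral => t; rewrite inE => -[_ /= ->].
Qed.

(** For a nonnegative function both sides are series over the fibers of [z], equal term by term by
    independence; a signed [phi] is split into its positive and negative parts. *)
Lemma Rintegral_indep (A : set Omega) (phi : nat -> R) :
  measurable A ->
  (forall n, P (A `&` z @^-1` [set n]) = P A * P (z @^-1` [set n]))%E ->
  P.-integrable setT (fun t => (phi (z t))%:E) ->
  \int[P]_(t in A) phi (z t) = fine (P A) * \int[P]_t phi (z t).
Proof.
move=> mA ind iphi.
have PAE : P A = (fine (P A))%:E by rewrite fineK// fin_num_measure.
have ge0 (g : nat -> \bar R) : (forall n, 0 <= g n)%E ->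
    (\int[P]_(t in A) g (z t) = P A * \int[P]_t g (z t))%E.
  move=> g0; rewrite !ge0_integral_fiber// PAE -nneseriesZl//; last first.
    by move=> n _; apply: mule_ge0.
  by apply: eq_eseriesr => n _; rewrite setTI -PAE ind muleCA.
have PAmul : (\int[P]_(t in A) ((EFin \o phi) \o z) t =
    P A * \int[P]_t ((EFin \o phi) \o z) t)%E.
  rewrite integralE [in RHS]integralE muleBr ?fin_num_measure//; last first.
    by apply: fin_num_adde_defr; exact: integrable_pos_fin_num.
  by rewrite funepos_comp funeneg_comp; congr (_ - _)%E; apply: ge0.
by rewrite /Rintegral PAmul fineM// ?fin_num_measure// integrable_fin_num.
Qed.

End Fibers.

(* Conditioning on the value of [z]: only the fibers of positive probability
   matter, so that a property known almost surely holds on each of them. *)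
Lemma Rintegral_indep_ge0 (z y : Omega -> nat) (g : nat -> nat -> R) :
  measurable_fun setT z -> measurable_fun setT y ->
  (forall m n, P (z @^-1` [set m] `&` y @^-1` [set n]) =
     P (z @^-1` [set m]) * P (y @^-1` [set n]))%E ->
  P.-integrable setT (fun t => (g (z t) (y t))%:E) ->
  (forall m, P (z @^-1` [set m]) != 0%E ->
     P.-integrable setT (fun t => (g m (y t))%:E) /\
     0 <= \int[P]_t g m (y t)) ->
  0 <= \int[P]_t g (z t) (y t).
Proof.
move=> mz my ind ig g0.
have intF m : \int[P]_(t in z @^-1` [set m]) g (z t) (y t) =
    \int[P]_(t in z @^-1` [set m]) g m (y t).
  by apply: eq_Rintegral => t; rewrite inE => /= ->.
rewrite /Rintegral fine_ge0// -(bigcup_fiber z setT) integral_bigcup;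
  last 3 first.
- exact: trivIset_fiber.
- by move=> m; rewrite setTI; exact: measurable_fiber.
- by rewrite bigcup_fiber.
apply: nneseries_ge0 => m _ _; rewrite setTI.
have mF := measurable_fiber mz m.
have [PF0|PF0] := eqVneq (P (z @^-1` [set m])) 0%E.
  rewrite null_set_integral//; apply: measurable_funTS.
  exact: measurable_int ig.
have [igm gm0] := g0 _ PF0.
rewrite -[leRHS]fineK; last first.
  by apply: integrable_fin_num => //; apply: integrableS ig.
(* On the fiber the first argument is frozen at [m]; independence then pulls out the probability of
   the fiber. *)
rewrite lee_fin -/(Rintegral _ _ _) intF (Rintegral_indep my)//.
by rewrite mulr_ge0// fine_ge0.
Qed.

End NatValued.

(** * Convex and Lipschitz functions on an interval *)

Section ConvexOn.
Context (R : realType).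
Implicit Types (f g : R -> R) (a b e x y : R).

Definition convex_on a b f := forall p x y : R, 0 <= p <= 1 ->
  a <= x <= b -> a <= y <= b ->
  f (p * x + (1 - p) * y) <= p * f x + (1 - p) * f y.

(** Convexity on the whole line, with real weights instead of [{i01 R}]: the Lipschitz bound on
    [a, b] evaluates [f] at [a - 1] and [b + 1]. *)
Definition is_convex f := forall p x y : R, 0 <= p <= 1 ->
  f (p * x + (1 - p) * y) <= p * f x + (1 - p) * f y.

Definition lipschitz_on_itv a b f := exists L : R, 0 <= L /\
  forall x y, a <= x <= b -> a <= y <= b -> `|f x - f y| <= L * `|x - y|.

Lemma convex_function_conv f : convex_function [set: R^o] f -> is_convex f.
Proof.
move=> cf p x y p01.
pose q : {i01 R} := Itv01 (proj1 (andP p01)) (proj2 (andP p01)).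
by apply: (cf q x y); rewrite inE.
Qed.

(** The three-point inequality cleared of denominators, so that the points may coincide. *)
Lemma convex_chord f x y z :
  is_convex f ->
  x <= y <= z -> f y * (z - x) <= f x * (z - y) + f z * (y - x).
Proof.
move=> cf /andP[xy yz]; have [xz|xz] := eqVneq x z.
  by have -> : y = x by [lra]; rewrite xz; lra.
have zx : 0 < z - x by lra.
pose p := (z - y) / (z - x).
have p01 : 0 <= p <= 1 by rewrite divr_ge0 ?ler_pdivrMr//=; lra.
have := cf p x z p01.
have -> : p * x + (1 - p) * z = y by rewrite /p; field; lra.
rewrite -(ler_pM2r zx) => h; apply: (le_trans h).
by rewrite le_eqVlt; apply/orP; left; apply/eqP; rewrite /p; field; lra.
Qed.

(** Slopes of chords increase: the slope over [x, y] is at most that over [y, b + 1] ([h2]), itself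
    at most that over [b, b + 1] ([h1]). *)
Lemma convex_upper_slope f b :
  is_convex f ->
  forall x y, x <= y <= b -> f y - f x <= (f (b + 1) - f b) * (y - x).
Proof.
move=> cf x y /andP[xy yb].
have h1 : f b * (b + 1 - y) <= f y * 1 + f (b + 1) * (b - y).
  by have := @convex_chord f y b (b + 1) cf; rewrite yb lerDl ler01; lra.
have h2 : f y * (b + 1 - x) <= f x * (b + 1 - y) + f (b + 1) * (y - x).
  by apply: convex_chord => //; lra.
have b1y : 0 < b + 1 - y by lra.
rewrite -(ler_pM2r b1y); set K := f (b + 1) in h1 h2 *.
suff : (f y - f x) * (b + 1 - y) <= (K - f y) * (y - x).
  move=> h3; apply: (le_trans h3).
  by rewrite [leRHS]mulrAC; apply: ler_wpM2r; lra.
lra.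
Qed.

(** The slopes just outside the two ends bound the increments in both directions; the bound at [a]
    is the right-end bound for the reflected function. *)
Lemma convex_lipschitz f a b :
  is_convex f ->
  lipschitz_on_itv a b f.
Proof.
move=> cf.
have cg : is_convex (f \o -%R).
  by move=> p u v p01 /=; rewrite opprD -!mulrN; exact: cf.
pose K := f (b + 1) - f b; pose K' := f (a - 1) - f a.
have up x y : x <= y <= b -> f y - f x <= K * (y - x).
  exact: convex_upper_slope.
have lo x y : a <= x <= y -> f x - f y <= K' * (y - x).
  move=> axy; have := @convex_upper_slope _ (- a) cg (- y) (- x).
  have -> : - a + 1 = - (a - 1) by ring.
  rewrite /= !opprK (addrC (- x)); apply; lra.
have sym x y : a <= x <= b -> a <= y <= b -> x <= y ->
    `|f x - f y| <= (`|K| + `|K'|) * `|x - y|.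
  move=> xab yab xy; rewrite distrC ler_norml (distrC x).
  rewrite (ger0_norm (_ : 0 <= y - x)) ?subr_ge0//.
  have := up x y; have := lo x y.
  have : K * (y - x) <= `|K| * (y - x).
    by apply: ler_wpM2r; [lra|exact: ler_norm].
  have : K' * (y - x) <= `|K'| * (y - x).
    by apply: ler_wpM2r; [lra|exact: ler_norm].
  have : 0 <= `|K| * (y - x) by apply: mulr_ge0 => //; lra.
  have : 0 <= `|K'| * (y - x) by apply: mulr_ge0 => //; lra.
  move=> h1 h2 h3 h4 h5 h6; apply/andP; split; lra.
exists (`|K| + `|K'|); split; first by rewrite addr_ge0.
move=> x y xab yab; case: (leP x y) => [xy|/ltW yx]; first exact: sym.
by rewrite distrC (distrC x); apply: sym.
Qed.

Lemma lipschitz_within_continuous f a b : lipschitz_on_itv a b f ->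
  {within `[a, b], continuous f}.
Proof.
move=> [L [L0 Lf]]; apply/subspace_continuousP => x /=; rewrite in_itv/= => xab.
(* [L] may be zero, so the divisor is [L + 1]. *)
apply/cvgrPdist_le => e e0; have L1 : 0 < L + 1 by lra.
have nx : \forall y \near nbhs x, `|x - y| <= e / (L + 1).
  by apply: (@cvgr_dist_le _ _ _ _ _ id); rewrite ?divr_gt0.
near=> y.
have : y \in `[a, b] by near: y; exact: withinT.
rewrite in_itv/= => yab; apply: (le_trans (Lf _ _ xab yab)).
have : `|x - y| <= e / (L + 1) by near: y; exact: cvg_within.
rewrite ler_pdivlMr// => h; have := normr_ge0 (x - y); lra.
Unshelve. all: by end_near.
Qed.

Lemma lipschitz_bounded f a b : lipschitz_on_itv a b f ->
  exists C, forall x, a <= x <= b -> `|f x| <= C.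
Proof.
move=> [L [L0 Lf]]; exists (`|f a| + L * `|b - a|) => x xab.
have ab : a <= a <= b by lra.
have := Lf x a xab ab.
have : `|x - a| <= `|b - a| by rewrite !ger0_norm; lra.
move=> /(ler_wpM2l L0) h1 h2.
rewrite -[f x](subrK (f a)) addrC; apply: le_trans (ler_normD _ _) _.
rewrite lerD2l; lra.
Qed.

Lemma lipschitz_argmin f a b : a <= b -> lipschitz_on_itv a b f ->
  exists m, a <= m <= b /\ forall y, a <= y <= b -> f m <= f y.
Proof.
move=> ab Lf; have [m] := EVT_min ab (lipschitz_within_continuous Lf).
rewrite in_itv/= => mab mf; by exists m.
Qed.

(** The point [x] is a convex combination of [m] and [y], and [f m <= f y]. *)
Lemma convex_argmin_homo f a b m : convex_on a b f -> a <= m <= b ->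
  (forall y, a <= y <= b -> f m <= f y) ->
  forall x y, m <= x -> x <= y -> y <= b -> f x <= f y.
Proof.
move=> cf mab mf x y mx xy yb.
have [my|my] := eqVneq m y; first by have -> : x = y by lra.
pose p := (y - x) / (y - m).
have ym : 0 < y - m by lra.
have p01 : 0 <= p <= 1 by rewrite /p divr_ge0 ?ler_pdivrMr//; lra.
have -> : x = p * m + (1 - p) * y by rewrite /p; field; lra.
have := cf p m y p01 mab; have mfy : f m <= f y by apply: mf; lra.
have : p * f m <= p * f y by apply: ler_wpM2l => //; lra.
move=> h1 /(_ _) h2; apply: (le_trans (h2 _)); lra.
Qed.

(** To the right of [m], [f] is convex and nondecreasing, and it is composed with the convex map
    [Num.max x m]. The lower end [l] is free because the maximum never drops below [m]: the value
    function must be convex on [xL, xU], while the stage cost is so only on [xL + D k, xU]. *)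
Lemma convex_on_max_argmin f a b m l u : convex_on a b f -> a <= m <= b ->
  (forall y, a <= y <= b -> f m <= f y) -> u <= b ->
  convex_on l u (fun x => f (Num.max x m)).
Proof.
move=> cf mab mf ub p x y p01 xlu ylu.
have mx : a <= Num.max x m <= b by rewrite le_max ge_max; lra.
have my : a <= Num.max y m <= b by rewrite le_max ge_max; lra.
apply: le_trans (cf p _ _ p01 mx my).
apply: (convex_argmin_homo cf mab mf); first by rewrite le_max lexx orbT.
  rewrite ge_max; apply/andP; split.
    by apply: lerD; apply: ler_wpM2l; rewrite ?le_max ?lexx//; lra.
  have : p * m <= p * Num.max x m.
    by apply: ler_wpM2l; rewrite ?le_max ?lexx ?orbT//; lra.
  have : (1 - p) * m <= (1 - p) * Num.max y m.
    by apply: ler_wpM2l; rewrite ?le_max ?lexx ?orbT//; lra.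
  lra.
have : p * Num.max x m <= p * b by apply: ler_wpM2l; lra.
have : (1 - p) * Num.max y m <= (1 - p) * b by apply: ler_wpM2l; lra.
lra.
Qed.

Lemma lipschitz_on_max f a b m l u : lipschitz_on_itv a b f -> a <= m <= b ->
  u <= b -> lipschitz_on_itv l u (fun x => f (Num.max x m)).
Proof.
move=> [L [L0 Lf]] mab ub; exists L; split=> // x y xlu ylu.
apply: le_trans (Lf _ _ _ _) _; rewrite ?le_max ?ge_max; [lra|lra|].
apply: ler_wpM2l => //.
have [mx|mx] := leP m x; have [my|my] := leP m y; rewrite ?subrr ?normr0//.
- by rewrite !ger0_norm; lra.
- by rewrite !ler0_norm; lra.
Qed.

(** The invariant of the backward induction. The Lipschitz half gives boundedness, hence
    integrability, and continuity up to the end points, hence minimizers; convexity alone gives no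
    continuity at the ends. *)
Definition regular_on a b f := convex_on a b f /\ lipschitz_on_itv a b f.

Lemma regular_onD a b f g : regular_on a b f -> regular_on a b g ->
  regular_on a b (fun x => f x + g x).
Proof.
move=> [cf [L1 [L10 lf]]] [cg [L2 [L20 lg]]]; split.
  move=> p x y p01 xab yab.
  have := cf p x y p01 xab yab; have := cg p x y p01 xab yab; lra.
exists (L1 + L2); split; first exact: addr_ge0.
move=> x y xab yab; rewrite mulrDl opprD addrACA.
apply: (le_trans (ler_normD _ _)); apply: lerD; [exact: lf|exact: lg].
Qed.

Lemma regular_on_linear a b e : regular_on a b (fun x => e * x).
Proof.
split.
  move=> p x y _ _ _; rewrite le_eqVlt; apply/orP; left; apply/eqP; ring.
exists `|e|; split=> // x y _ _.
by rewrite -mulrBr normrM.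
Qed.

Lemma regular_on_convex a b f : is_convex f -> regular_on a b f.
Proof.
by move=> cf; split; [move=> p x y p01 _ _; exact: cf|exact: convex_lipschitz].
Qed.

End ConvexOn.

(** * Histories of demands *)

(** Choice picks the common value of [G] on each fiber; [v0] serves the naturals that [z] does not
    attain. *)
Lemma factor_through (S V : Type) (v0 : V) (z : S -> nat) (G : S -> V) :
  (forall t t', z t = z t' -> G t = G t') ->
  exists phi : nat -> V, forall t, G t = phi (z t).
Proof.
move=> zG.
have choose n : exists v, forall t, z t = n -> G t = v.
  have [[t <-]|none] := pselect (exists t, z t = n).
    by exists (G t) => t' /zG.
  by exists v0 => t ztn; case: none; exists t.
by have [phi phiP] := choice choose; exists phi => t; exact: phiP.
Qed.

Section Histories.
Context (R : realType) (disp : measure_display) (Omega : measurableType disp)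
  (P : probability Omega R).

Lemma measurable_factor (z : Omega -> nat) (G : Omega -> R) :
  measurable_fun setT z -> (forall t t', z t = z t' -> G t = G t') ->
  measurable_fun setT G.
Proof.
move=> mz /(factor_through 0)[phi phiE].
by rewrite (funext phiE); exact: measurable_fun_nat.
Qed.

Lemma measurable_fun_fibers (z : Omega -> nat) :
  (forall n, measurable (z @^-1` [set n])) -> measurable_fun setT z.
Proof.
move=> mz _ B _; rewrite setTI.
have -> : z @^-1` B = \bigcup_(n in B) (z @^-1` [set n]).
  by apply/seteqP; split=> [t Bt|t [n Bn /= ->]//]; exists (z t).
by apply: bigcup_measurable => n _; exact: mz.
Qed.

Variables (T : nat) (w : nat -> {dRV P >-> R}).

Lemma demand_code_ex (k : nat) :
  exists e : R -> nat, {in range (w k) &, injective e}.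
Proof. by apply/countable_injP; exact: countable_range. Qed.

Definition demand_code (k : nat) : R -> nat := projT1 (cid (demand_code_ex k)).

Definition demand_index (k : nat) (t : Omega) : nat := demand_code k (w k t).

Lemma demand_index_inj (k : nat) (t t' : Omega) :
  demand_index k t = demand_index k t' -> w k t = w k t'.
Proof.
rewrite /demand_index /demand_code; case: cid => e einj /= /einj.
by apply; rewrite inE; [exists t|exists t'].
Qed.

Lemma measurable_demand_fiber (k : nat) (r : R) :
  measurable (w k @^-1` [set r]).
Proof. by rewrite -[_ @^-1` _]setTI; apply: measurable_funP. Qed.

Lemma demand_index_fiber (k : nat) (t0 : Omega) :
  demand_index k @^-1` [set demand_index k t0] = w k @^-1` [set w k t0].
Proof.
apply/seteqP; split=> t /=; first exact: demand_index_inj.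
by rewrite /demand_index => ->.
Qed.

Lemma measurable_demand_index (k : nat) : measurable_fun setT (demand_index k).
Proof.
apply: measurable_fun_fibers => n.
have [[t0 <-]|none] := pselect (exists t, demand_index k t = n).
  by rewrite demand_index_fiber; exact: measurable_demand_fiber.
rewrite (_ : _ @^-1` _ = set0)//.
by apply/seteqP; split=> // t /= tn; apply: none; exists t.
Qed.

(** An arbitrary [phi] of a discrete demand factors through a natural number. This covers the value
    functions, whose regularity is known only on [xL, xU]. *)
Lemma measurable_demand_comp (k : nat) (phi : R -> R) :
  measurable_fun setT (fun t => phi (w k t)).
Proof.
apply: (measurable_factor (measurable_demand_index k)) => t t'.
by move=> /demand_index_inj ->.
Qed.

(** The range of [w k] is countable, so the exceptional set is a countable union of atoms outside
    [a, b], each null because [pmf] vanishes there. *)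
Lemma ae_demand_support (k : nat) (a b : R) : support_in P (w k) a b ->
  {ae P, forall t, a <= w k t <= b}.
Proof.
move=> supp; rewrite /almost_everywhere/=.
apply: (@negligibleS _ _ _ _ (\bigcup_n (demand_index k @^-1` [set n] `&`
    ~` [set t | a <= w k t <= b]))).
  by move=> t /= tN; exists (demand_index k t).
apply: negligible_bigcup => n.
have [[t0 [<- t0N]]|none] := pselect (exists t, demand_index k t = n /\
    ~ (a <= w k t <= b)); last first.
  rewrite (_ : _ `&` _ = set0); first exact: negligible_set0.
  by apply/seteqP; split=> // t [/= tn tN]; apply: none; exists t.
rewrite demand_index_fiber.
apply: (@negligibleS _ _ _ _ (w k @^-1` [set w k t0])).
  by move=> t [].
apply/negligibleP; first exact: measurable_demand_fiber.
apply: contrapT => /eqP PN0; apply: t0N; apply: supp.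
rewrite /pmf; apply: contra_neq PN0 => pmf0; rewrite -[LHS]fineK ?pmf0//.
by rewrite fin_num_measure//; exact: measurable_demand_fiber.
Qed.

(* All of [w 0], ..., [w k.-1] in one natural number, so that every function
   of the past demands is measurable. *)
Fixpoint history (k : nat) (t : Omega) : nat :=
  if k is j.+1 then pickle (history j t, demand_index j t) else 0.

Lemma historyP (k : nat) (t t' : Omega) :
  history k t = history k t' <-> (forall j, (j < k)%N -> w j t = w j t').
Proof.
elim: k => [|k IH] /=; first by split.
split=> [/(pcan_inj pickleK)[/IH tt' ktt'] j|tt'].
  rewrite ltnS leq_eqVlt => /predU1P[->|]; last exact: tt'.
  exact: demand_index_inj.
have /IH -> : forall j, (j < k)%N -> w j t = w j t'.
  by move=> j jk; apply: tt'; exact: ltnW.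
by rewrite /demand_index (tt' k).
Qed.

(* The event that the demands before stage [k] are those of [t0] and the demand
   at stage [k] is in [B], as a product of sets indexed by the stages. *)
Definition history_box (k : nat) (t0 : Omega) (B : set R) (j : nat) : set R :=
  if (j < k)%N then [set w j t0] else if j == k then B else setT.

Lemma history_boxE (k : nat) (t0 : Omega) (B : set R) : (k < T)%N ->
  \bigcap_(j in `I_T) (w j @^-1` history_box k t0 B j) =
  history k @^-1` [set history k t0] `&` w k @^-1` B.
Proof.
move=> kT; apply/seteqP; split=> t.
  move=> tA; split.
    apply/historyP => j jk; have := tA j (ltn_trans jk kT).
    by rewrite /history_box /preimage /= jk.
  by have := tA k kT; rewrite /history_box /preimage /= ltnn eqxx.
move=> [/= /historyP tt0 Bt] j jT; rewrite /history_box /preimage /=.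
by case: ifPn => [/tt0|_] //; case: eqP => [->|].
Qed.

Lemma measurable_history (k : nat) : measurable_fun setT (history k).
Proof.
elim: k => [|k IH]; first exact: measurable_cst.
apply: measurable_fun_fibers => n.
have [[t0 <-]|none] := pselect (exists t, history k.+1 t = n); last first.
  rewrite (_ : _ @^-1` _ = set0)//.
  by apply/seteqP; split=> // t /= tn; apply: none; exists t.
have -> : history k.+1 @^-1` [set history k.+1 t0] =
    history k @^-1` [set history k t0] `&`
    demand_index k @^-1` [set demand_index k t0].
  apply/seteqP; split=> [t /= /(pcan_inj pickleK)[]//|t [/= -> ->]//].
by apply: measurableI; apply: measurable_fiber => //;
  exact: measurable_demand_index.
Qed.

Lemma history_indep (k m n : nat) : mutually_independent P T w -> (k < T)%N ->
  P (history k @^-1` [set m] `&` demand_index k @^-1` [set n]) =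
  (P (history k @^-1` [set m]) * P (demand_index k @^-1` [set n]))%E.
Proof.
move=> ind kT.
have [[t1 t1n]|none] := pselect (exists t, demand_index k t = n); last first.
  rewrite (_ : demand_index k @^-1` _ = set0); last first.
    by apply/seteqP; split=> // t /= tn; apply: none; exists t.
  by rewrite setI0 measure0 mule0.
have [[t0 t0m]|none] := pselect (exists t, history k t = m); last first.
  rewrite (_ : history k @^-1` _ = set0); last first.
    by apply/seteqP; split=> // t /= tn; apply: none; exists t.
  by rewrite set0I measure0 mul0e.
rewrite -t1n -t0m demand_index_fiber.
(* The factor of the past does not depend on [B]. Taking [B] to be the whole line identifies it as
   the probability of the history; taking a singleton gives the claim. *)
have box B : measurable B ->
    P (history k @^-1` [set history k t0] `&` w k @^-1` B) =
    (P (w k @^-1` B) * \prod_(j < T | j != Ordinal kT)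
       P (w j @^-1` history_box k t0 setT j))%E.
  move=> mB; rewrite -history_boxE// ind; last first.
    move=> j; rewrite /history_box; case: ifP => // _; last by case: ifP.
  rewrite (bigD1 (Ordinal kT))//= {1}/history_box ltnn eqxx; congr (_ * _)%E.
  apply: eq_bigr => j jk; rewrite /history_box; case: ifP => // _.
  by have /negbTE -> : nat_of_ord j != k by exact: jk.
have := box setT measurableT.
rewrite preimage_setT setIT probability_setT mul1e => ->.
by rewrite box// muleC.
Qed.

End Histories.

(** * Dynamic programming *)

Section DynamicProgramming.
Context (R : realType) (disp : measure_display) (Omega : measurableType disp)
  (P : probability Omega R).
Variables (T : nat) (xL xU c : R) (f : R -> R) (d D : nat -> R)
  (w : nat -> {dRV P >-> R}).
Hypothesis f_convex : is_convex f.
Hypothesis w_support : forall k, (k < T)%N -> support_in P (w k) (d k) (D k).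
Hypothesis d_ge0 : forall k, (k < T)%N -> 0 <= d k.
Hypothesis bounds : forall k, (k < T)%N -> xL + D k <= xU.

(** The lower bound comes from [u <= D k], the upper one from [0 <= d k <= u]. *)
Lemma stock_after_demand k y u : (k < T)%N -> xL + D k <= y <= xU ->
  d k <= u <= D k -> xL <= y - u <= xU.
Proof. by move=> kT yk uk; have := d_ge0 kT; lra. Qed.

Lemma ae_stock_after_demand k y : (k < T)%N -> xL + D k <= y <= xU ->
  {ae P, forall t, xL <= y - w k t <= xU}.
Proof.
move=> kT yk; have := ae_demand_support (w_support kT).
by apply: filterS => t; exact: stock_after_demand.
Qed.

Lemma integrable_stock g k y : regular_on xL xU g -> (k < T)%N ->
  xL + D k <= y <= xU -> P.-integrable setT (fun t => (g (y - w k t))%:E).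
Proof.
move=> [_ /lipschitz_bounded[C gC]] kT yk.
apply: (@ae_bounded_integrable _ _ _ _ (fun t => g (y - w k t)) C).
  exact: (measurable_demand_comp _ _ (fun u => g (y - u))).
by apply: filterS (ae_stock_after_demand kT yk) => t; exact: gC.
Qed.

(** Both inequalities survive translation by almost every demand and are then integrated; since [P]
    has total mass one, the Lipschitz constant is kept. *)
Lemma regular_expectation g k : regular_on xL xU g -> (k < T)%N ->
  regular_on (xL + D k) xU (fun y => \int[P]_t g (y - w k t)).
Proof.
move=> rg kT; have ig := integrable_stock rg kT.
have [cg [L [L0 lg]]] := rg; split.
  move=> p x y p01 xk yk.
  have pk : xL + D k <= p * x + (1 - p) * y <= xU by nra.
  rewrite -RintegralZl ?ig// -RintegralZl ?ig// -RintegralD//; last 2 first.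
  - by have := integrableZl measurableT p (ig _ xk).
  - by have := integrableZl measurableT (1 - p) (ig _ yk).
  apply: ae_le_Rintegral; first exact: ig.
    have := integrableD measurableT (integrableZl measurableT p (ig _ xk))
      (integrableZl measurableT (1 - p) (ig _ yk)).
    by [].
  apply: filterS2 (ae_stock_after_demand kT xk) (ae_stock_after_demand kT yk).
  move=> t xt yt; have := cg p _ _ p01 xt yt; congr (g _ <= _); ring.
exists L; split=> //.
have le x y : xL + D k <= x <= xU -> xL + D k <= y <= xU ->
    \int[P]_t g (x - w k t) <= \int[P]_t g (y - w k t) + L * `|x - y|.
  move=> xk yk.
  have -> : L * `|x - y| = \int[P]_(t in setT) (L * `|x - y|).
    by rewrite Rintegral_cst//= -[X in fine X]/(P setT) probability_setT mulr1.
  rewrite -RintegralD ?ig//; last exact: finite_measure_integrable_cst.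
  apply: ae_le_Rintegral; first exact: ig.
    have := integrableD measurableT (ig _ yk)
      (finite_measure_integrable_cst P (L * `|x - y|) measurableT).
    by [].
  apply: filterS2 (ae_stock_after_demand kT xk) (ae_stock_after_demand kT yk).
  move=> t xt yt; have := lg _ _ xt yt.
  have -> : x - w k t - (y - w k t) = x - y by ring.
  rewrite ler_norml => /andP[_]; lra.
move=> x y xk yk; rewrite ler_norml; have := le x y xk yk.
by have := le y x yk xk; rewrite (distrC y); lra.
Qed.

(** * Regularity of the value functions, and the thresholds *)

Notation Q_of_ := (Q_of c f w).
Notation J_ := (J T xL xU c f D w).
Notation Q_ := (Q T xL xU c f D w).
Notation cost_to_go_ := (cost_to_go xL xU c f D w).

Lemma Q_ofE Jnext k y : Q_of_ Jnext k y =
  c * y + \int[P]_t (f (y - w k t) + Jnext (y - w k t)).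
Proof. by rewrite /Q_of unlock. Qed.

Lemma regular_Q_of Jnext k : regular_on xL xU Jnext -> (k < T)%N ->
  regular_on (xL + D k) xU (Q_of_ Jnext k).
Proof.
move=> rJ kT; rewrite (funext (Q_ofE Jnext k)).
apply: regular_onD; first exact: regular_on_linear.
apply: (regular_expectation (g := fun x => f x + Jnext x)) => //.
by apply: regular_onD => //; exact: regular_on_convex.
Qed.

Lemma order_up_to_max k x m : x <= xU -> xL + D k <= m <= xU ->
  order_up_to xL xU D k x (Num.max x m).
Proof. by move=> xU' mk; rewrite /order_up_to/= !le_max ge_max lexx/=; lra. Qed.

(** If [x < m], the global minimizer is admissible; otherwise [g] is nondecreasing from [m] on, so
    the smallest admissible level [x] is best. *)
Lemma order_up_to_min g k x m : convex_on (xL + D k) xU g ->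
  xL + D k <= m <= xU -> (forall y, xL + D k <= y <= xU -> g m <= g y) ->
  forall y, order_up_to xL xU D k x y -> g (Num.max x m) <= g y.
Proof.
move=> cg mk mg y [xy yk].
have [mx|mx] := leP m x; last exact: mg.
apply: (convex_argmin_homo cg mk mg) => //; lra.
Qed.

Lemma cost_to_goS_argmin n k x m :
  convex_on (xL + D k) xU (Q_of_ (cost_to_go_ n k.+1) k) ->
  xL + D k <= m <= xU ->
  (forall y, xL + D k <= y <= xU ->
    Q_of_ (cost_to_go_ n k.+1) k m <= Q_of_ (cost_to_go_ n k.+1) k y) ->
  x <= xU ->
  cost_to_go_ n.+1 k x = Q_of_ (cost_to_go_ n k.+1) k (Num.max x m) - c * x.
Proof.
move=> /=; set q := Q_of_ _ _ => cq mk mq xU'; congr (_ - _).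
have qmin y : order_up_to xL xU D k x y -> q (Num.max x m) <= q y.
  exact: order_up_to_min.
(* A real [inf] is meaningful for a nonempty set with a lower bound; the attained minimum provides
   both. *)
have qm : [set q y | y in order_up_to xL xU D k x] (q (Num.max x m)).
  by exists (Num.max x m) => //; exact: order_up_to_max.
have lbq : lbound [set q y | y in order_up_to xL xU D k x] (q (Num.max x m)).
  by move=> _ [y yk <-]; exact: qmin.
apply/eqP; rewrite eq_le; apply/andP; split.
  by apply: ge_inf => //; exists (q (Num.max x m)).
by apply: lb_le_inf => //; exists (q (Num.max x m)).
Qed.

Lemma regular_cost_to_go n k : (n + k = T)%N ->
  regular_on xL xU (cost_to_go_ n k).
Proof.
elim: n k => [|n IH] k nkT.
  split; first by move=> p x y _ _ _ /=; rewrite !mulr0 addr0.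
  by exists 0; split=> // x y _ _ /=; rewrite subrr normr0 mul0r.
have kT : (k < T)%N by rewrite -nkT addSn ltnS leq_addl.
have rJ : regular_on xL xU (cost_to_go_ n k.+1) by apply: IH; rewrite addnS.
have [cQ lQ] := regular_Q_of rJ kT.
have [m [mk mmin]] := lipschitz_argmin (bounds kT) lQ.
have rmax : regular_on xL xU
    (fun x => Q_of_ (cost_to_go_ n k.+1) k (Num.max x m) + (- c) * x).
  apply: regular_onD; last exact: regular_on_linear.
  split; first exact: (convex_on_max_argmin cQ mk mmin).
  exact: (lipschitz_on_max _ lQ mk (lexx _)).
have E x : xL <= x <= xU -> cost_to_go_ n.+1 k x =
    Q_of_ (cost_to_go_ n k.+1) k (Num.max x m) + (- c) * x.
  move=> /andP[_ xU']; rewrite mulNr.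
  exact: (cost_to_goS_argmin cQ mk mmin xU').
have [cm [L [L0 lm]]] := rmax; split.
  move=> p x y p01 xk yk; rewrite !E//; first exact: cm.
  by nra.
by exists L; split=> // x y xk yk; rewrite !E//; exact: lm.
Qed.

Lemma regular_J k : (k <= T)%N -> regular_on xL xU (J_ k).
Proof. by move=> kT; apply: regular_cost_to_go; rewrite subnK. Qed.

Lemma regular_Q k : (k < T)%N -> regular_on (xL + D k) xU (Q_ k).
Proof. by move=> kT; apply: regular_Q_of => //; exact: regular_J. Qed.

(** The constraint [x <= y] is dropped from the minimization, which makes the threshold independent
    of the inventory level. *)
Definition is_threshold (k : nat) (m : R) := xL + D k <= m <= xU /\
  forall y, xL + D k <= y <= xU -> Q_ k m <= Q_ k y.

Lemma ex_threshold k : (k < T)%N -> exists m, is_threshold k m.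
Proof.
move=> kT; have [_ lQ] := regular_Q kT.
exact: lipschitz_argmin (bounds kT) lQ.
Qed.

Lemma J_threshold k m x : (k < T)%N -> is_threshold k m -> x <= xU ->
  J_ k x = Q_ k (Num.max x m) - c * x.
Proof.
move=> kT [mk mmin] xU'; have [cQ _] := regular_Q kT.
by rewrite /J -subnSK//; exact: (cost_to_goS_argmin cQ mk mmin xU').
Qed.

Lemma J_le k x y : (k < T)%N -> x <= xU -> order_up_to xL xU D k x y ->
  J_ k x <= Q_ k y - c * x.
Proof.
move=> kT xU' xy; have [m tm] := ex_threshold kT.
rewrite (J_threshold kT tm xU') lerD2r.
have [cQ _] := regular_Q kT; case: tm => mk mmin.
exact: (order_up_to_min cQ mk mmin).
Qed.

(** The clamp is inactive: [M k - x] lies between the two bounds, and when it is negative so is the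
    lower bound, while the upper bound stays nonnegative, so the request is 0. *)
Lemma threshold_policyE M k x : xL + D k <= M k <= xU -> x <= xU ->
  x + threshold_policy xL xU D M k x = Num.max x (M k).
Proof.
move=> Mk xU'; rewrite /threshold_policy /clamp /pos_part.
have [h1|h1] := leP x (M k).
  rewrite (max_l (_ : 0 <= M k - x)) ?subr_ge0// max_l; last lra.
  by rewrite min_r; lra.
rewrite (max_r (_ : M k - x <= 0)); last lra.
by rewrite max_l ?min_r; lra.
Qed.

Lemma threshold_bellman_optimal M k x : (k < T)%N -> is_threshold k (M k) ->
  x <= xU ->
  bellman_optimal P T xL xU c f D w k x (threshold_policy xL xU D M k x).
Proof.
move=> kT [mk mmin] xU'; have [cQ _] := regular_Q kT.
rewrite /bellman_optimal threshold_policyE//; split.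
  exact: order_up_to_max.
exact: (order_up_to_min cQ mk mmin).
Qed.

(** * Verification: optimality among all feasible policies *)

Section Verification.
Hypothesis w_indep : mutually_independent P T w.
Variables (x0 : R).
Hypothesis x0_bound : xL <= x0 <= xU.

Lemma level_history N k t t' : history w k t = history w k t' ->
  level w N x0 k t = level w N x0 k t'.
Proof.
move=> /historyP; elim: k => [//|k IH] tt' /=.
rewrite (tt' k)// IH// => j jk; apply: tt'; exact: ltnW.
Qed.

Definition stage_gain (N : policy R) (k : nat) (t : Omega) : R :=
  let x := level w N x0 k t in
  c * N k x + f (x + N k x - w k t) + J_ k.+1 (x + N k x - w k t) - J_ k x.

Lemma total_cost_gain N t :
  total_cost T c f w N x0 t = J_ 0 x0 + \sum_(k < T) stage_gain N k t.
Proof.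
have JT x : J_ T x = 0 by rewrite /J subnn.
(* Telescoping leaves the value function at the current level, which vanishes at the horizon. *)
suff partial n : \sum_(k < n) (c * N k (level w N x0 k t)
    + f (level w N x0 k t + N k (level w N x0 k t) - w k t)) =
    J_ 0 x0 + \sum_(k < n) stage_gain N k t - J_ n (level w N x0 n t).
  by rewrite /total_cost partial JT subr0.
elim: n => [|n IH]; first by rewrite !big_ord0 addr0 subrr.
by rewrite !big_ord_recr /= IH /stage_gain; ring.
Qed.

Lemma feasible_stage N k : feasible T xL xU D w N x0 -> (k < T)%N ->
  {ae P, forall t, let x := level w N x0 k t in
    [/\ xL <= x <= xU, xL <= x + N k x - w k t <= xU,
      xL + D k <= x + N k x <= xU & 0 <= N k x]}.
Proof.
move=> fN kT; apply: filterS fN => t [lev ord] /=.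
have [? ?] := ord k kT; split=> //; first by apply: lev; exact: ltnW.
exact: (lev k.+1 kT).
Qed.

Lemma measurable_stage_gain N k : measurable_fun setT (stage_gain N k).
Proof.
(* The history up to [k.+1] is needed, as the gain of stage [k] also involves the demand [w k]. *)
apply: (measurable_factor (measurable_history w k.+1)) => t t' tt'.
have ktt' : history w k t = history w k t'.
  by apply/historyP => j jk; move/historyP: tt'; apply; exact: ltnW.
move/historyP: tt' => /(_ k (ltnSn k)) wtt'.
by rewrite /stage_gain wtt' (level_history N ktt').
Qed.

Lemma integrable_stage_gain N k : feasible T xL xU D w N x0 -> (k < T)%N ->
  P.-integrable setT (EFin \o stage_gain N k).
Proof.
move=> fN kT.
have [_ /lipschitz_bounded[C1 f1]] := regular_on_convex xL xU f_convex.
have [_ /lipschitz_bounded[C2 f2]] := regular_J kT.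
have [_ /lipschitz_bounded[C3 f3]] := regular_J (ltnW kT).
apply: (@ae_bounded_integrable _ _ _ _ _ (`|c| * (xU - xL) + C1 + C2 + C3)).
  exact: measurable_stage_gain.
apply: filterS (feasible_stage fN kT) => t /= [xk yk nk N0].
rewrite /stage_gain; set x := level _ _ _ _ _ in xk yk nk N0 *.
apply: (le_trans (ler_normB _ _)); apply: lerD; last exact: f3.
apply: (le_trans (ler_normD _ _)); apply: lerD; last exact: f2.
apply: (le_trans (ler_normD _ _)); apply: lerD; last exact: f1.
(* A request leads from a level above [xL] to a stock below [xU], so it is at most [xU - xL]. *)
rewrite normrM; apply: ler_wpM2l => //; rewrite ger0_norm//; lra.
Qed.

(* The sign [sg] is [1] for an arbitrary policy and [-1] for the threshold
   policy. *)
Lemma stage_gain_Rintegral_ge0 N k (sg : R) :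
  feasible T xL xU D w N x0 -> (k < T)%N ->
  (forall x, xL <= x <= xU -> order_up_to xL xU D k x (x + N k x) ->
    0 <= sg * (Q_ k (x + N k x) - c * x - J_ k x)) ->
  0 <= \int[P]_t (sg * stage_gain N k t).
Proof.
move=> fN kT stage_ge0.
(* The level and the demand become functions of two independent natural numbers, the codes of the
   past and of the present. *)
have [lam lamE] := factor_through 0 (@level_history N k).
have [rho rhoE] := factor_through 0 (@demand_index_inj _ _ _ _ w k).
pose G x u :=
  sg * (c * N k x + f (x + N k x - u) + J_ k.+1 (x + N k x - u) - J_ k x).
have GE t : sg * stage_gain N k t =
    G (lam (history w k t)) (rho (demand_index w k t)).
  by rewrite /G -lamE -rhoE.
have -> : \int[P]_t (sg * stage_gain N k t) =
    \int[P]_t G (lam (history w k t)) (rho (demand_index w k t)).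
  by apply: eq_Rintegral => t _; exact: GE.
apply: (@Rintegral_indep_ge0 _ _ _ _ _ _ (fun m n => G (lam m) (rho n))).
- exact: measurable_history.
- exact: measurable_demand_index.
- by move=> m n; exact: (history_indep _ _ w_indep kT).
- have := integrableZl measurableT sg (integrable_stage_gain fN kT).
  apply: eq_integrable => // t _; rewrite /= -GE EFinM//.
move=> m Fm.
(* Feasibility holds only almost surely, but a history of positive probability contains a point
   where it holds, and the level there is the level on the whole fiber. *)
have [t0 <- /= [xk yk nk N0]] := ae_exists_in
  (measurable_fiber (measurable_history w k) m) Fm (feasible_stage fN kT).
rewrite -lamE; set x := level w N x0 k t0 in xk yk nk N0 *.
have rg : regular_on xL xU (fun u => f u + J_ k.+1 u).
  by apply: regular_onD; [exact: regular_on_convex|exact: regular_J].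
have ig := integrable_stock rg kT nk.
have GxE t : G x (rho (demand_index w k t)) =
    sg * (c * N k x - J_ k x) +
    sg * (f (x + N k x - w k t) + J_ k.+1 (x + N k x - w k t)).
  by rewrite -rhoE /G; ring.
have icst := finite_measure_integrable_cst P
  (sg * (c * N k x - J_ k x)) measurableT.
have isg := integrableZl measurableT sg ig.
split.
  have := integrableD measurableT icst isg.
  by apply: eq_integrable => // t _; rewrite /= GxE EFinD EFinM.
have -> : \int[P]_t G x (rho (demand_index w k t)) =
    sg * (Q_ k (x + N k x) - c * x - J_ k x).
  transitivity (\int[P]_t (sg * (c * N k x - J_ k x) +
      sg * (f (x + N k x - w k t) + J_ k.+1 (x + N k x - w k t)))).
    by apply: eq_Rintegral => t _; exact: GxE.
  rewrite (@RintegralD _ _ _ _ _ (cst (sg * (c * N k x - J_ k x))))//.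
  rewrite RintegralZl// Rintegral_cst// -[X in fine X]/(P setT).
  rewrite probability_setT [Q_ _ _]Q_ofE.
  rewrite [fine 1]/=; ring.
apply: stage_ge0 => //; split=> //; lra.
Qed.

(** Integrability is carried through the induction together with the sign, because additivity of the
    integral requires it. *)
Lemma sum_stage_gain N (sg : R) (n : nat) :
  feasible T xL xU D w N x0 -> (n <= T)%N ->
  (forall k x, (k < T)%N -> xL <= x <= xU ->
    order_up_to xL xU D k x (x + N k x) ->
    0 <= sg * (Q_ k (x + N k x) - c * x - J_ k x)) ->
  P.-integrable setT (fun t => (\sum_(k < n) stage_gain N k t)%:E) /\
  0 <= sg * \int[P]_t \sum_(k < n) stage_gain N k t.
Proof.
move=> fN + stage_ge0; elim: n => [_|n IH nT].
  under eq_fun do rewrite big_ord0.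
  under eq_Rintegral do rewrite big_ord0.
  split; first exact: finite_measure_integrable_cst.
  by rewrite Rintegral_cst// mul0r mulr0.
have [iS S0] := IH (ltnW nT); have ig := integrable_stage_gain fN nT.
under eq_fun do rewrite big_ord_recr/=.
under eq_Rintegral do rewrite big_ord_recr/=.
split.
  by have := integrableD measurableT iS ig.
rewrite RintegralD// mulrDr addr_ge0// -RintegralZl//.
by apply: stage_gain_Rintegral_ge0 => // x; exact: stage_ge0.
Qed.

Lemma threshold_feasible M :
  (forall k, (k < T)%N -> xL + D k <= M k <= xU) ->
  feasible T xL xU D w (threshold_policy xL xU D M) x0.
Proof.
move=> Mk; set N := threshold_policy xL xU D M.
(* A single null set must serve all stages, since a level depends on every earlier demand. *)
have aew : {ae P, forall t, forall k, (k < T)%N -> d k <= w k t <= D k}.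
  apply: ae_foralln => k; case: (ltnP k T) => [kT|_]; last exact: aeW.
  by apply: filterS (ae_demand_support (w_support kT)) => t.
apply: filterS aew => t wt.
have lev k : (k <= T)%N -> xL <= level w N x0 k t <= xU.
  elim: k => [//|k IH kT] /=; have /andP[_ xk] := IH (ltnW kT).
  rewrite threshold_policyE ?Mk//.
  apply: (stock_after_demand kT); last exact: wt.
  by have := order_up_to_max xk (Mk _ kT) => -[].
split=> // k kT; have /andP[_ xk] := lev k (ltnW kT).
have [xy yk] := order_up_to_max xk (Mk _ kT).
rewrite threshold_policyE ?Mk//; split=> //.
by move: xy; rewrite -(threshold_policyE (Mk _ kT) xk) lerDl.
Qed.

Lemma threshold_optimal M : (forall k, (k < T)%N -> is_threshold k (M k)) ->
  optimal_policy P T xL xU c f D w (threshold_policy xL xU D M) x0.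
Proof.
move=> tM; set N := threshold_policy xL xU D M.
have fN : feasible T xL xU D w N x0.
  by apply: threshold_feasible => k /tM[].
split=> // N' fN'.
have costE N1 : feasible T xL xU D w N1 x0 ->
    ('E_P[total_cost T c f w N1 x0] =
     (J_ 0 x0 + \int[P]_t \sum_(k < T) stage_gain N1 k t)%:E)%E.
  move=> fN1.
  (* The sign 0 makes the hypothesis on the gains trivial; only integrability is wanted here. *)
  have [iS _] :
      P.-integrable setT (fun t => (\sum_(k < T) stage_gain N1 k t)%:E)
      /\ 0 <= 0 * \int[P]_t \sum_(k < T) stage_gain N1 k t.
    by apply: sum_stage_gain => // *; rewrite mul0r.
  have iJ := finite_measure_integrable_cst P (J_ 0 x0) measurableT.
  rewrite unlock; under eq_integral do rewrite total_cost_gain EFinD.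
  rewrite integralD//= integral_cst// -[X in (_ * X)%E]/(P setT).
  rewrite probability_setT mule1 EFinD fineK//.
  exact: integrable_fin_num.
(* Zero separates the two expected gains: sign -1 bounds that of the threshold policy above, sign 1
   bounds that of [N'] below. *)
rewrite !costE// lee_fin lerD2l; apply: (@le_trans _ _ 0).
  have [|_] := @sum_stage_gain N (-1) T fN (leqnn T).
    move=> k x kT /andP[_ xk] _; have tk := tM k kT.
    rewrite threshold_policyE//; last by case: tk.
    by rewrite (J_threshold kT tk xk) subrr mulr0.
  by rewrite mulN1r oppr_ge0.
have [|_] := @sum_stage_gain N' 1 T fN' (leqnn T); last by rewrite mul1r.
move=> k x kT /andP[_ xk] ord; rewrite mul1r subr_ge0.
exact: J_le.
Qed.

End Verification.
End DynamicProgramming.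

Theorem lemma1 (R : realType) (disp : measure_display)
    (Omega : measurableType disp) (P : probability Omega R)
    (T : nat) (xL xU : R) (f : R -> R -> R -> R) (d D : nat -> R)
    (w : nat -> {dRV P >-> R})
    (f_convex : forall s h : R, 0 < s -> 0 < h ->
       convex_function [set: R^o] (f s h))
    (w_support : forall k, (k < T)%N -> support_in P (w k) (d k) (D k))
    (w_indep : mutually_independent P T w)
    (d_ge0 : forall k, (k < T)%N -> 0 <= d k)
    (bounds : forall k, (k < T)%N -> xL + D k <= xU) :
  exists M : R -> R -> R -> nat -> R,
  forall c s h : R, 0 < c -> 0 < s -> 0 < h ->
    (forall k, (k < T)%N -> forall x : R, xL <= x <= xU ->
       bellman_optimal P T xL xU c (f s h) D w k x
         (threshold_policy xL xU D (M c s h) k x)) /\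
    (forall x0 : R, xL <= x0 <= xU ->
       optimal_policy P T xL xU c (f s h) D w
         (threshold_policy xL xU D (M c s h)) x0).
Proof.
(* Some minimizer is selected for each choice of prices, before any inventory level is given. The
   default 0 cannot occur for [k < T] and positive prices, where a minimizer exists. *)
exists (fun c s h k => xget 0 (is_threshold T xL xU c (f s h) D w k)).
move=> c s h c0 s0 h0.
have cf := convex_function_conv (f_convex s h s0 h0).
have tM k : (k < T)%N -> is_threshold T xL xU c (f s h) D w k
    (xget 0 (is_threshold T xL xU c (f s h) D w k)).
  move=> kT; have [m tm] := ex_threshold c cf w_support d_ge0 bounds kT.
  exact: xgetI tm.
split=> [k kT x /andP[_ xk]|x0 x0b].
  exact: (threshold_bellman_optimal cf w_support d_ge0 bounds kT (tM k kT)).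
exact: (threshold_optimal cf w_support d_ge0 bounds w_indep).
Qed.
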